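(* Let $C_7\approx7.9776615835$ be the largest root of the polynomial $$833089536x^{28}+220028016384x^{26}-19474287964848x^{24}+139707882692901x^{22}-410390834384412x^{20}$$ $$+732430210466916x^{18}-892396597211316x^{16}+782711166381062x^{14}-492062343977916x^{12}+216425700787620x^{10}$$ $$-65960002546284x^8+14226627485565x^6-2259294716376x^4+253570773456x^2-14637417984.$$ For every triangle, the following bounds hold, where a bound $L\le \frac{D(n,i)}{D(n,j)}\le U$ means $L\,D(n,j)\le D(n,i)\le U\,D(n,j)$ (and similarly for one-sided bounds and equalities): $$\frac{D(7,1)}{D(7,2)}\le\frac34,\quad \frac{D(7,1)}{D(7,3)}\le\frac2{17}\left(5-2\sqrt2\right),\quad \frac{D(7,1)}{D(7,4)}\le1,\quad \frac{D(7,1)}{D(7,8)}\le\frac12,\quad \frac{D(7,1)}{D(7,9)}\le\frac12,\quad \frac{D(7,1)}{D(7,10)}\le\frac23,$$ $$\frac{D(7,2)}{D(7,3)}\le\frac23,\quad 2\le\frac{D(7,2)}{D(7,6)},\quad \frac13\le\frac{D(7,2)}{D(7,8)}\le\frac23,\quad \frac{D(7,2)}{D(7,9)}=\frac23,\quad \frac23\le\frac{D(7,2)}{D(7,10)}\le\frac89,$$ $$\frac12\le\frac{D(7,3)}{D(7,4)},\quad 2\le\frac{D(7,3)}{D(7,5)},\quad C_7\le\frac{D(7,3)}{D(7,6)},\quad \frac12\le\frac{D(7,3)}{D(7,8)},\quad 1\le\frac{D(7,3)}{D(7,9)},\quad 1\le\frac{D(7,3)}{D(7,10)},$$ $$1\le\frac{D(7,4)}{D(7,6)},\quad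 \frac{D(7,6)}{D(7,8)}\le\frac13,\quad \frac{D(7,6)}{D(7,9)}\le\frac13,\quad \frac{D(7,6)}{D(7,10)}\le\frac49,$$ $$1\le\frac{D(7,8)}{D(7,9)}\le2,\quad \frac43\le\frac{D(7,8)}{D(7,10)}\le2,\quad 1\le\frac{D(7,9)}{D(7,10)}\le\frac43.$$
   Context: For a (nondegenerate) triangle $ABC$ with side lengths $a=BC$, $b=CA$, $c=AB$, a point with barycentric coordinates $(u:v:w)$ is $(uA+vB+wC)/(u+v+w)$. For $1\le n\le 10$ the triangle center $X_n$ is the point with barycentric coordinates $(f_n(a,b,c):f_n(b,c,a):f_n(c,a,b))$, where $f_1=a$ (incenter); $f_2=1$ (centroid); $f_3=a^2(a^2-b^2-c^2)$ (circumcenter); $f_4=(a^2+b^2-c^2)(a^2-b^2+c^2)$ (orthocenter); $f_5=c^4-a^2b^2+b^4-a^2c^2-2b^2c^2$ (nine-point center); $f_6=a^2$ (symmedian point); $f_7=(a+b-c)(a-b+c)$ (Gergonne point); $f_8=a-b-c$ (Nagel point); $f_9=a(a-b-c)$ (mittenpunkt); $f_{10}=b+c$ (Spieker center). $D(i,j)$ denotes the Euclidean distance between $X_i$ and $X_j$. Roots of polynomials are real roots. *)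

(* Defs.v *)
From Stdlib Require Export Reals.
Open Scope R_scope.

Definition point : Type := (R * R)%type.

Definition dist (P Q : point) : R := dist_euc (fst P) (snd P) (fst Q) (snd Q).

(** [A], [B], [C] are not collinear: twice the signed area is nonzero. *)
Definition nondegenerate (A B C : point) : Prop :=
  (fst B - fst A) * (snd C - snd A) - (fst C - fst A) * (snd B - snd A) <> 0.

Definition barycentric (A B C : point) (u v w : R) : point :=
  ((u * fst A + v * fst B + w * fst C) / (u + v + w),
   (u * snd A + v * snd B + w * snd C) / (u + v + w)).

(** The index is a plain [nat]; only the values 1 to 10 are meaningful, 0 is a
    junk value elsewhere. *)
Definition center_function (n : nat) (a b c : R) : R :=
  match n with
  | 1%nat => a
  | 2%nat => 1
  | 3%nat => a^2 * (a^2 - b^2 - c^2)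
  | 4%nat => (a^2 + b^2 - c^2) * (a^2 - b^2 + c^2)
  | 5%nat => c^4 - a^2 * b^2 + b^4 - a^2 * c^2 - 2 * b^2 * c^2
  | 6%nat => a^2
  | 7%nat => (a + b - c) * (a - b + c)
  | 8%nat => a - b - c
  | 9%nat => a * (a - b - c)
  | 10%nat => b + c
  | _ => 0
  end.

Definition center (A B C : point) (n : nat) : point :=
  let a := dist B C in
  let b := dist C A in
  let c := dist A B in
  barycentric A B C
    (center_function n a b c)
    (center_function n b c a)
    (center_function n c a b).

Definition D (A B C : point) (i j : nat) : R :=
  dist (center A B C i) (center A B C j).

Definition poly7 (x : R) : R :=
  833089536 * x^28 + 220028016384 * x^26 - 19474287964848 * x^24
  + 139707882692901 * x^22 - 410390834384412 * x^20
  + 732430210466916 * x^18 - 892396597211316 * x^16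
  + 782711166381062 * x^14 - 492062343977916 * x^12
  + 216425700787620 * x^10 - 65960002546284 * x^8
  + 14226627485565 * x^6 - 2259294716376 * x^4
  + 253570773456 * x^2 - 14637417984.

Definition is_largest_root (p : R -> R) (r : R) : Prop :=
  p r = 0 /\ forall x : R, p x = 0 -> x <= r.

(* Main.v *)
(** Write the sides as [a = y + z], [b = z + x], [c = x + y] with tangent lengths [x, y, z > 0],
    and put [p = x + y + z], [q = (xy + yz + zx)/p^2], [s = xyz/(p(xy + yz + zx))].  The squared
    distances from [X7] to the other centers, divided by [p^2], are rational functions of
    low degree in [(q, s)], and [(q, s)] ranges over a cusped region bounded by the vanishing of
    the discriminant of the cubic with roots [x, y, z].  Every bound thereby becomes a
    polynomial inequality on that region.

    All constants come from the boundary of the region, except [C7], which comes from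
    a critical point [(q0, s0)] in its interior (a scalene triangle).  Its coordinates and
    [y = C7^2] lie in the number field generated by a root [s0] of a polynomial of degree 14, where
    [y] is checked to be a root of the given polynomial.  Since [y] solves the three equations
    of a critical point exactly, the Taylor expansion of the numerator of [D(7,3)^2 - y D(7,6)^2]
    starts with second-order terms; as the numerator is cubic in [q], it is a quadratic form with
    polynomial coefficients, and positivity needs only rough numerical
    bounds. *)

From Stdlib Require Import Reals Lra Psatz Lia List ZArith.
Require Import Defs.
Import ListNotations.
Open Scope R_scope.

(** * Squared distances from the Gergonne point *)

(** [D(7,i)^2 / p^2] as a function of [q] and [s]; the value at 7 is junk. *)
Definition delta (i : nat) (q s : R) : R :=
  match i with
  | 1%nat => s * (q - 3 * s)
  | 2%nat => (1 + 6 * s - 27 * s^2 - 4 * q) / 9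
  | 3%nat => (q * (1 - s)^2 - 16 * s^2 * (1 + 3 * s)) / (16 * s)
  | 4%nat => (1 - s) * (q * (1 - s) - 4 * s * (1 - 3 * s)) / (4 * s)
  | 5%nat => (q * (1 - 34 * s + s^2) + 96 * s^2 * (1 - 2 * s)) / (64 * s)
  | 6%nat => (q^2 * (1 + 9 * s) * (1 - 3 * s) + 36 * q * s^2 - 12 * s^2 - 4 * q^3)
             / (4 * (1 - q)^2)
  | 8%nat => (1 - s) * (1 + 3 * s - 4 * q)
  | 9%nat => (1 + 6 * s - 27 * s^2 - 4 * q) / 4
  | 10%nat => (1 + 4 * s - 4 * q - 12 * s^2 + q * s) / 4
  | _ => 0
  end.

Lemma dist_sqr (P Q : point) : dist P Q ^ 2 = (fst P - fst Q)^2 + (snd P - snd Q)^2.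
Proof.
  unfold dist, dist_euc. rewrite pow2_sqrt; [unfold Rsqr; ring|].
  apply Rplus_le_le_0_compat; apply Rle_0_sqr.
Qed.

(** The differences of normalized coordinates sum to zero, and a displacement [(u, v, w)] of zero
    sum has squared length [-(a^2 v w + b^2 w u + c^2 u v)]. The sums [S], [S'] are parameters so
    that they can be supplied in factored form. *)
Lemma barycentric_dist_sqr (A B C : point) (u v w S u' v' w' S' : R) :
  u + v + w = S -> u' + v' + w' = S' -> S <> 0 -> S' <> 0 ->
  dist (barycentric A B C u v w) (barycentric A B C u' v' w') ^ 2 =
  - (dist B C ^ 2 * (v / S - v' / S') * (w / S - w' / S')
     + dist C A ^ 2 * (w / S - w' / S') * (u / S - u' / S')
     + dist A B ^ 2 * (u / S - u' / S') * (v / S - v' / S')).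
Proof.
  intros E E' H H'. rewrite !dist_sqr. unfold barycentric; simpl.
  rewrite E, E'.
  replace u with (S - v - w) by lra. replace u' with (S' - v' - w') by lra.
  field. auto.
Qed.

Lemma gergonne_dist_sqr (A B C : point) (x y z : R) :
  0 < x -> 0 < y -> 0 < z ->
  dist B C = y + z -> dist C A = z + x -> dist A B = x + y ->
  let p := x + y + z in let q1 := x * y + y * z + z * x in
  forall i : nat, (1 <= i <= 10)%nat -> i <> 7%nat ->
  D A B C 7 i ^ 2 = p^2 * delta i (q1 / p^2) (x * y * z / (p * q1)).
Proof.
  intros Hx Hy Hz Ha Hb Hc p q1 i Hi H7. unfold p, q1.
  assert (0 < x * y) by nra. assert (0 < y * z) by nra. assert (0 < z * x) by nra.
  assert (0 < x * y * z) by nra.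
  assert (Hpq : 0 < (x + y + z)^2 - (x * y + y * z + z * x)) by nra.
  assert (Hpr : 0 < (x + y + z) * (x * y * z)) by nra.
  (** [S] is the coordinate sum of the second center; for the Gergonne point the sum is
      [4 (xy + yz + zx)]. Positivity of [x, y, z] gives each sum a fixed sign. *)
  Ltac center_dist A B C x y z Ha Hb Hc S :=
    unfold D, center, center_function; rewrite Ha, Hb, Hc;
    rewrite (barycentric_dist_sqr A B C _ _ _ (4 * (x * y + y * z + z * x)) _ _ _ S);
    [rewrite Ha, Hb, Hc; unfold delta; field; repeat split; nra|ring|ring|nra|nra].
  destruct i as [|[|[|[|[|[|[|[|[|[|[|i]]]]]]]]]]]; try lia.
  - center_dist A B C x y z Ha Hb Hc (2 * (x + y + z)).
  - center_dist A B C x y z Ha Hb Hc 3.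
  - center_dist A B C x y z Ha Hb Hc (- 16 * ((x + y + z) * (x * y * z))).
  - center_dist A B C x y z Ha Hb Hc (16 * ((x + y + z) * (x * y * z))).
  - center_dist A B C x y z Ha Hb Hc (- 32 * ((x + y + z) * (x * y * z))).
  - center_dist A B C x y z Ha Hb Hc (2 * ((x + y + z)^2 - (x * y + y * z + z * x))).
  - center_dist A B C x y z Ha Hb Hc (- 2 * (x + y + z)).
  - center_dist A B C x y z Ha Hb Hc (- 4 * (x * y + y * z + z * x)).
  - center_dist A B C x y z Ha Hb Hc (4 * (x + y + z)).
Qed.

(** * The region of triangles in the [(q, s)] plane *)

(** The third condition says that the discriminant of the cubic with roots [x, y, z] is
    nonnegative; the last one is Schur's inequality [p^3 - 4 p (xy + yz + zx) + 9 xyz >= 0].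
    The cusp [q = 1/3], [s = 1/9] is the equilateral triangle. *)
Definition region (q s : R) : Prop :=
  0 < s <= 1/9 /\ 3 * s <= q <= 1/3 /\
  4 * q^2 + 4 * s <= q * (1 + 18 * s - 27 * s^2) /\ 0 <= 1 - 4 * q + 9 * (q * s).

(** By symmetry the arguments may be ordered; the sum is then [(a-b)^2 (a+b-c) + c (a-c) (b-c)],
    with both terms nonnegative. *)
Lemma schur (x y z : R) :
  0 <= x -> 0 <= y -> 0 <= z ->
  0 <= x * (x - y) * (x - z) + y * (y - x) * (y - z) + z * (z - x) * (z - y).
Proof.
  assert (W : forall a b c, 0 <= c -> c <= b -> b <= a ->
    0 <= a * (a - b) * (a - c) + b * (b - a) * (b - c) + c * (c - a) * (c - b)).
  { intros a b c Hc Hb Ha.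
    replace (a * (a - b) * (a - c) + b * (b - a) * (b - c) + c * (c - a) * (c - b))
      with ((a - b)^2 * (a + b - c) + c * ((a - c) * (b - c))) by ring.
    apply Rplus_le_le_0_compat; apply Rmult_le_pos; try apply pow2_ge_0; try lra.
    apply Rmult_le_pos; lra. }
  intros Hx Hy Hz.
  pose proof (W x y z). pose proof (W x z y). pose proof (W y x z).
  pose proof (W y z x). pose proof (W z x y). pose proof (W z y x).
  destruct (Rle_lt_dec x y), (Rle_lt_dec y z), (Rle_lt_dec x z); lra.
Qed.

(** Apart from [0 < s], every slack is an explicit quotient with positive denominator: the numerator
    is a sum of squares with positive weights, the square of [(x-y)(y-z)(z-x)] for the discriminant,
    or Schur's expression. *)
Lemma triangle_region (x y z : R) :
  0 < x -> 0 < y -> 0 < z ->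
  let p := x + y + z in let q1 := x * y + y * z + z * x in
  region (q1 / p^2) (x * y * z / (p * q1)).
Proof.
  intros Hx Hy Hz p q1.
  assert (0 < x * y) by nra. assert (0 < y * z) by nra. assert (0 < z * x) by nra.
  assert (Hr : 0 < x * y * z) by nra.
  assert (Hp : 0 < p) by (unfold p; lra). assert (Hq : 0 < q1) by (unfold q1; lra).
  assert (Hpq : 0 < p * q1) by (apply Rmult_lt_0_compat; lra).
  assert (Hp2 : 0 < p^2) by (apply pow_lt; lra).
  assert (Hp2q : 0 < p^2 * q1) by (apply Rmult_lt_0_compat; lra).
  assert (N : forall u v w, u - v = w -> 0 <= w -> v <= u) by (intros; lra).
  assert (Hx2 := pow2_ge_0 (x - y)). assert (Hy2 := pow2_ge_0 (y - z)).
  assert (Hz2 := pow2_ge_0 (z - x)).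
  repeat split.
  - apply Rdiv_lt_0_compat; lra.
  - apply N with ((x * (y - z)^2 + y * (z - x)^2 + z * (x - y)^2) / (9 * (p * q1))).
    + unfold p, q1 in *. field; repeat split; lra.
    + apply Rle_mult_inv_pos; [|lra].
      repeat apply Rplus_le_le_0_compat; apply Rmult_le_pos; lra.
  - apply N with (((x * y - y * z)^2 + (y * z - z * x)^2 + (z * x - x * y)^2) / (2 * (p^2 * q1))).
    + unfold p, q1 in *. field; repeat split; lra.
    + apply Rle_mult_inv_pos; [|lra].
      repeat apply Rplus_le_le_0_compat; apply pow2_ge_0.
  - apply N with (((x - y)^2 + (y - z)^2 + (z - x)^2) / (6 * p^2)).
    + unfold p, q1 in *. field; repeat split; lra.
    + apply Rle_mult_inv_pos; lra.
  - apply N with (((x - y) * (y - z) * (z - x))^2 / (p^4 * q1)).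
    + unfold p, q1 in *. field; repeat split; lra.
    + apply Rle_mult_inv_pos; [apply pow2_ge_0|apply Rmult_lt_0_compat; [apply pow_lt|]; lra].
  - apply N with ((x * (x - y) * (x - z) + y * (y - x) * (y - z) + z * (z - x) * (z - y)) / p^3).
    + unfold p, q1 in *. field; repeat split; lra.
    + apply Rle_mult_inv_pos; [apply schur; lra|apply pow_lt; lra].
Qed.

(** By Heron's formula the product of the three doubled tangent lengths is positive. Any two of them
    have nonnegative sum, so a nonpositive one would make the other two nonnegative and the product
    nonpositive. *)
Lemma tangent_lengths (A B C : point) :
  nondegenerate A B C ->
  exists x y z : R, (0 < x /\ 0 < y /\ 0 < z) /\
    dist B C = y + z /\ dist C A = z + x /\ dist A B = x + y.
Proof.
  unfold nondegenerate. intros H.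
  pose proof (dist_sqr B C) as Ha. pose proof (dist_sqr C A) as Hb. pose proof (dist_sqr A B) as Hc.
  assert (N : forall P Q, 0 <= dist P Q) by (intros; apply sqrt_pos).
  pose proof (N B C). pose proof (N C A). pose proof (N A B). clear N.
  set (a := dist B C) in *. set (b := dist C A) in *. set (c := dist A B) in *.
  set (k := (fst B - fst A) * (snd C - snd A) - (fst C - fst A) * (snd B - snd A)) in *.
  assert (Heron : (a + b + c) * ((b + c - a) * (c + a - b) * (a + b - c)) = 4 * k^2).
  { transitivity (2 * (a^2 * b^2 + b^2 * c^2 + c^2 * a^2) - (a^2 * a^2 + b^2 * b^2 + c^2 * c^2)).
    - ring.
    - rewrite Ha, Hb, Hc. unfold k. ring. }
  assert (0 < k^2) by (rewrite <- Rsqr_pow2; apply Rsqr_pos_lt, H).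
  clearbody a b c k. clear Ha Hb Hc H.
  exists ((b + c - a) / 2), ((c + a - b) / 2), ((a + b - c) / 2).
  split; [|repeat split; field].
  assert (P : 0 < (b + c - a) * (c + a - b) * (a + b - c)).
  { apply Rmult_lt_reg_l with (a + b + c); [|lra].
    destruct (Req_dec (a + b + c) 0) as [E|]; [rewrite E in Heron|]; lra. }
  clear Heron.
  assert (Pos : forall u v w, 0 <= u + v -> 0 <= u + w -> 0 < u * v * w -> 0 < u).
  { intros u v w Hv Hw Huvw. apply Rnot_le_lt. intros Hu.
    assert (0 <= - u * (v * w)) by (apply Rmult_le_pos; [|apply Rmult_le_pos]; lra). lra. }
  pose proof (Pos (b + c - a) (c + a - b) (a + b - c)).
  pose proof (Pos (c + a - b) (b + c - a) (a + b - c)).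
  pose proof (Pos (a + b - c) (b + c - a) (c + a - b)).
  lra.
Qed.

(** * Bounds whose constants come from the boundary of the region *)

(** The left side of the discriminant condition minus the right side is a convex quadratic in
    [q], decreasing for [8 q <= 1 + 18 s - 27 s^2]; the hypotheses say that [beta / alpha] lies
    there and that the quadratic is nonnegative at it. *)
Lemma linear_lower (q s alpha beta : R) :
  4 * q^2 + 4 * s <= q * (1 + 18 * s - 27 * s^2) -> 0 < alpha ->
  8 * beta <= alpha * (1 + 18 * s - 27 * s^2) ->
  0 <= 4 * beta^2 - alpha * beta * (1 + 18 * s - 27 * s^2) + 4 * s * alpha^2 ->
  beta <= alpha * q.
Proof.
  intros D a b H. apply Rnot_lt_le; intros N.
  assert (alpha^2 * (4*q^2 + 4*s) <= alpha^2 * (q*(1+18*s-27*s^2)))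
    by (apply Rmult_le_compat_l; [apply pow2_ge_0|exact D]).
  nra.
Qed.

Lemma linear_upper (q s alpha beta : R) :
  4 * q^2 + 4 * s <= q * (1 + 18 * s - 27 * s^2) -> 0 < alpha ->
  alpha * (1 + 18 * s - 27 * s^2) <= 8 * beta ->
  0 <= 4 * beta^2 - alpha * beta * (1 + 18 * s - 27 * s^2) + 4 * s * alpha^2 ->
  alpha * q <= beta.
Proof.
  intros D a b H. apply Rnot_lt_le; intros N.
  assert (alpha^2 * (4*q^2 + 4*s) <= alpha^2 * (q*(1+18*s-27*s^2)))
    by (apply Rmult_le_compat_l; [apply pow2_ge_0|exact D]).
  nra.
Qed.

(** Products of the defining inequalities, collected as certificate terms for [delta_le]. *)
Lemma region_products (q s : R) :
  region q s ->
  0 <= q * s * (1 - 3 * q) /\ 0 <= q * s * (q - 3 * s) /\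
  0 <= s * (1 - 4 * q + 9 * (q * s)) /\ 0 <= q * (1 - 4 * q + 9 * (q * s)) /\
  0 <= (1 - 3 * q) * (1 - 4 * q + 9 * (q * s)) /\ 0 <= q * s * (1 - 4 * q + 9 * (q * s))
  /\ 0 <= s * (1 - 3 * q).
Proof.
  intros (Hs & Hq & _ & Hsch). repeat split; repeat apply Rmult_le_pos; lra.
Qed.

Lemma delta_le (q s : R) :
  region q s ->
  16/9 * delta 1 q s <= delta 2 q s /\
  9/4 * delta 2 q s <= delta 8 q s /\ 1/9 * delta 8 q s <= delta 2 q s /\
  81/64 * delta 2 q s <= delta 10 q s /\ 4/9 * delta 10 q s <= delta 2 q s /\
  16/9 * delta 10 q s <= delta 8 q s /\ 1/4 * delta 8 q s <= delta 10 q s /\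
  4 * delta 6 q s <= delta 2 q s.
Proof.
  intros Hr. pose proof (region_products q s Hr) as (H1 & H2 & H3 & H4 & H5 & H6 & H7).
  destruct Hr as (Hs & Hq & HD & Hsch).
  (* Multiplication by [q] raises the differences to a degree where the products from
     [region_products] can certify their sign. *)
  assert (C : forall u v, 0 <= q * (v - u) -> u <= v).
  { intros u v H. apply Rmult_le_reg_l with q; lra. }
  split; [unfold delta; nra|].
  (* The goal on [delta 6] is set aside: its denominator [(1 - q)^2] is cleared afterwards. *)
  repeat match goal with
  | |- _ /\ _ => split
  | |- _ * delta 6 q s <= _ => idtac
  | |- _ <= _ => apply C; unfold delta; first [lra | nra]
  end.
  assert (N : q^2 * (1 + 9 * s) * (1 - 3 * s) + 36 * q * s^2 - 12 * s^2 - 4 * q^3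
              <= (1 - q)^2 * delta 2 q s) by (unfold delta; nra).
  apply Rmult_le_reg_l with ((1 - q)^2); [apply pow_lt; lra|].
  unfold delta at 1.
  match goal with |- ?u <= _ => match type of N with ?v <= _ =>
    replace u with v by (field; lra) end end.
  exact N.
Qed.

(** The factors [1 - 9 s] appear because all the lines used pass through the cusp. *)
Lemma linear_lower_cusp (q s alpha beta f g : R) :
  region q s -> 0 < alpha -> 0 <= f -> 0 <= g ->
  alpha * (1 + 18 * s - 27 * s^2) - 8 * beta = (1 - 9 * s) * f ->
  4 * beta^2 - alpha * beta * (1 + 18 * s - 27 * s^2) + 4 * s * alpha^2 = (1 - 9 * s)^2 * (s * g) ->
  beta <= alpha * q.
Proof.
  intros (Hs & _ & HD & _) Ha Hf Hg E1 E2. apply linear_lower with s; [exact HD|exact Ha| |].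
  - assert (0 <= (1 - 9 * s) * f) by (apply Rmult_le_pos; lra). lra.
  - rewrite E2. apply Rmult_le_pos; [apply pow2_ge_0|apply Rmult_le_pos; lra].
Qed.

Lemma delta_3_4_le (q s : R) :
  region q s ->
  9/4 * delta 2 q s <= delta 3 q s /\ 1/4 * delta 8 q s <= delta 3 q s /\
  delta 10 q s <= delta 3 q s /\ 1/4 * delta 4 q s <= delta 3 q s /\
  4 * delta 5 q s <= delta 3 q s /\ delta 1 q s <= delta 4 q s /\ delta 6 q s <= delta 4 q s.
Proof.
  intros Hr. pose proof Hr as (Hs & Hq & _).
  (* Up to positive factors, [L2], [L8], [L10], [L5] are the bounds of [delta 3] against [delta 2],
     [delta 8], [delta 10], [delta 5] multiplied by [s], and [L1] is that of [delta 4] against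
     [delta 1]; all are linear in [q]. The last two explicit arguments are the cofactors of
     [1 - 9 s] and of [(1 - 9 s)^2 s]. *)
  assert (L5 : 7 * s - 9 * s^2 <= 2 * q)
    by (apply (linear_lower_cusp q s _ _ (2 * (1 - s)) (2 * (1 - s)) Hr); try lra; ring).
  assert (L2 : 4*s + 40*s^2 - 60*s^3 <= (1 + 14*s + s^2) * q)
    by (apply (linear_lower_cusp q s _ _ (1 + 9*s - 13*s^2 + 3*s^3)
          (4*s*(1-s)*(2+25*s+5*s^2)) Hr); try ring; repeat apply Rmult_le_pos; nra).
  assert (L8 : 4*s + 24*s^2 + 36*s^3 <= (1 + 14*s - 15*s^2) * q)
    by (apply (linear_lower_cusp q s _ _ (1 + 9*s + 99*s^2 - 45*s^3)
          (4*s*(6+55*s+48*s^2-45*s^3)) Hr); try ring; repeat apply Rmult_le_pos; nra).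
  assert (L10 : 4*s + 32*s^2 <= (1 + 14*s - 3*s^2) * q)
    by (apply (linear_lower_cusp q s _ _ (1 + 9*s + 47*s^2 - 9*s^3)
          (16*s*(1+10*s-2*s^2)) Hr); try ring; repeat apply Rmult_le_pos; nra).
  assert (L1 : 4*s - 16*s^2 <= ((1 - 3*s) * (1 + s)) * q)
    by (apply (linear_lower_cusp q s _ _ (1 - 7*s - s^2 - 9*s^3) (16*s^3) Hr);
        try ring; repeat apply Rmult_le_pos; nra).
  assert (C : forall u v, 0 <= s * (v - u) -> u <= v).
  { intros u v H. apply Rmult_le_reg_l with s; lra. }
  assert (E3 : s * delta 3 q s = (q * (1 - s)^2 - 16 * s^2 * (1 + 3 * s)) / 16)
    by (unfold delta; field; lra).
  assert (E4 : s * delta 4 q s = (1 - s) * (q * (1 - s) - 4 * s * (1 - 3 * s)) / 4)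
    by (unfold delta; field; lra).
  assert (E5 : s * delta 5 q s = (q * (1 - 34 * s + s^2) + 96 * s^2 * (1 - 2 * s)) / 64)
    by (unfold delta; field; lra).
  repeat split; apply C; rewrite Rmult_minus_distr_l.
  - rewrite E3. unfold delta. lra.
  - rewrite E3. unfold delta. lra.
  - rewrite E3. unfold delta. lra.
  - replace (s * (1/4 * delta 4 q s)) with (1/4 * (s * delta 4 q s)) by ring.
    rewrite E3, E4. assert (0 <= s * (q - 3 * s)) by (apply Rmult_le_pos; lra). nra.
  - replace (s * (4 * delta 5 q s)) with (4 * (s * delta 5 q s)) by ring.
    rewrite E3, E5. nra.
  - rewrite E4. unfold delta. lra.
  (* Here [delta 4 - delta 1 = X / (4 s)], while [HK] says that [delta 6 - delta 1] is at most
     [q X / (4 (1 - q)^2)]. It remains to see that [q s <= (1 - q)^2]. *)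
  - set (X := ((1 - 3*s) * (1 + s)) * q - (4*s - 16*s^2)).
    assert (HX : 0 <= X) by (unfold X; lra).
    assert (HS : 0 <= q^2 + s^2 + 3*s^2*q + s*q^2 - 4*s*q)
      by (clear E3 E4 E5 L2 L8 L10 X HX C; destruct Hr as (_ & _ & HD & _); nra).
    set (K := q^2 * (1 + 9 * s) * (1 - 3 * s) + 36 * q * s^2 - 12 * s^2 - 4 * q^3).
    assert (HK : K <= 4 * s * (q - 3 * s) * (1 - q)^2 + q * X).
    { unfold K, X. assert (0 <= q * (q^2 + s^2 + 3*s^2*q + s*q^2 - 4*s*q))
        by (apply Rmult_le_pos; lra). lra. }
    assert (E6 : s * delta 6 q s = s * K / (4 * (1 - q)^2)) by (unfold delta, K; field; lra).
    assert (E4' : s * delta 4 q s = (4 * s^2 * (q - 3 * s) + X) / 4)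
      by (rewrite E4; unfold X; field).
    rewrite E6, E4'.
    replace ((4 * s^2 * (q - 3 * s) + X) / 4 - s * K / (4 * (1 - q)^2))
      with ((s * (4 * s * (q - 3 * s) * (1 - q)^2 + q * X - K) + X * ((1 - q)^2 - q * s))
            / (4 * (1 - q)^2)) by (field; lra).
    apply Rle_mult_inv_pos; [|assert (0 < (1 - q)^2) by (apply pow_lt; lra); lra].
    apply Rplus_le_le_0_compat; apply Rmult_le_pos; try lra. clear - Hs Hq. nra.
Qed.

(** The constant is the square of [(5 + 2 t) / 2], the reciprocal of [2/17 (5 - 2 t)]. Multiplied by
    [16 s], the bound becomes [alpha q <= beta]. *)
Lemma sqrt2_delta_1_le (q s t : R) :
  region q s -> 0 < t -> t^2 = 2 -> (33 + 20 * t) / 4 * delta 1 q s <= delta 3 q s.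
Proof.
  intros (Hs & Hq & HD & _) Ht Ht2.
  assert (It : 14/10 <= t <= 15/10) by nra.
  set (alpha := (131 + 80 * t) * s^2 + 2 * s - 1). set (beta := (348 + 240 * t) * s^3 - 16 * s^2).
  assert (H : alpha * q <= beta).
  (* For [alpha <= 0] the left side is largest at the smallest value [q = 3 s]; otherwise an upper
     bound on [q] is needed. *)
  { destruct (Rle_lt_dec alpha 0) as [Ha|Ha].
    - apply Rle_trans with (alpha * (3 * s)); [apply Rmult_le_compat_neg_l; lra|].
      assert (0 <= s * ((1 - 9 * s) * (3 + 5 * s))) by (repeat apply Rmult_le_pos; lra).
      unfold alpha, beta. lra.
    - apply linear_upper with s; [exact HD|exact Ha| |].
      + assert (0 <= (1 - 9 * s) * (1 + 25 * s - (97 + 80 * t) * s^2 - (393 + 240 * t) * s^3)).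
        { apply Rmult_le_pos; [lra|].
          (* These two facts replace [t] by its upper bound [15/10], leaving a cubic in [s]
             alone. *)
          assert (0 <= (15/10 - t) * s^2) by (apply Rmult_le_pos; [lra|apply pow_le; lra]).
          assert (0 <= (15/10 - t) * s^3) by (apply Rmult_le_pos; [lra|apply pow_le; lra]).
          assert (0 <= 1 + 25 * s - 217 * s^2 - 753 * s^3) by (clear - Hs; nra). lra. }
        unfold alpha, beta. lra.
      + (* The double root [s = (5 - 3 sqrt 2) / 7] is the isosceles triangle
           [x = y = sqrt 2 * z], where equality holds. *)
        replace (4 * beta^2 - alpha * beta * (1 + 18 * s - 27 * s^2) + 4 * s * alpha^2)
          with ((1 - 9*s)^2 * ((7 * s - (5 - 3 * t))^2 * (s * ((172 + 120 * t) / 49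
              + (4880 + 3432 * t) / 49 * s + (27996 + 19760 * t) / 49 * s^2)))).
        * apply Rmult_le_pos; [apply pow2_ge_0|]. apply Rmult_le_pos; [apply pow2_ge_0|].
          apply Rmult_le_pos; [lra|].
          assert (0 <= (4880 + 3432 * t) / 49 * s) by (apply Rmult_le_pos; lra).
          assert (0 <= (27996 + 19760 * t) / 49 * s^2)
            by (apply Rmult_le_pos; [lra|apply pow2_ge_0]).
          lra.
        * unfold alpha, beta. field [Ht2]. }
  apply Rmult_le_reg_l with (16 * s); [lra|].
  replace (16 * s * delta 3 q s) with (q * (1 - s)^2 - 16 * s^2 * (1 + 3 * s))
    by (unfold delta; field; lra).
  unfold alpha, beta in H. unfold delta. lra.
Qed.

(** * The critical point *)

Definition poly (l : list Z) (x : R) : R :=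
  fold_right (fun c acc => IZR c + x * acc) 0 l.

Lemma poly_continuity (l : list Z) : continuity (poly l).
Proof.
  induction l as [|c l IH]; intros x.
  - apply continuity_pt_const. intros ? ?. reflexivity.
  - change (continuity_pt ((fun _ => IZR c) + id * poly l)%F x).
    apply continuity_pt_plus.
    + apply continuity_pt_const. intros ? ?. reflexivity.
    + apply continuity_pt_mult; [apply derivable_continuous_pt, derivable_pt_id|apply IH].
Qed.

(** Obtained by eliminating [q] and [y] from [crit = crit_q = crit_s = 0]. *)
Definition s_poly : list Z :=
   [3; 144; -3585; -238; 69650; 553588; 1307478; 4028028; 26355471; 29778192; 39729483;
    29015010; 3457404; -212868; 139968]%Z.

Definition s_poly' : list Z :=
   [144; -7170; -714; 278600; 2767940; 7844868; 28196196; 210843768; 268003728; 397294830;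
    319165110; 41488848; -2767284; 1959552]%Z.

(** In the number field of [s_poly], the other coordinates of the critical point are
    [q = q_num / s_poly'] and [y = y_num / (248 * s_poly')]: with the derivative as the
    denominator, the coefficients of the numerators are small. *)
Definition q_num : list Z :=
   [-204; -11520; 279084; -287272; -5722960; -32464416; 684024; 48105552; -1344070476;
    -486971424; -1949686308; -515557224; 34647912; -10357632]%Z.

Definition y_num : list Z :=
   [-17267513; 245168514; 203921441; -3217001972; -33268730252; -76019149604; -203558730486;
    -1674152442864; -1866467007849; -2541824495118; -1900223501931; -227822804172;
    14343196014; -9167834016]%Z.

(** [poly7] as a polynomial in the square of its variable. *)
Definition y_poly : list Z :=
   [-14637417984; 253570773456; -2259294716376; 14226627485565; -65960002546284;
    216425700787620; -492062343977916; 782711166381062; -892396597211316; 732430210466916;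
    -410390834384412; 139707882692901; -19474287964848; 220028016384; 833089536]%Z.

(** One step of the Horner scheme for [y_poly] at [y]; a partial value [H] is represented by the
    numerator [n] of [8 * H] over the denominator [d = s_poly'], and [w] is the quotient in
    the reduction of the product modulo [s_poly]. *)
Lemma horner_step (s y H d : R) (c : Z) (n n' w : list Z) :
  poly s_poly s = 0 -> d <> 0 -> 248 * y * d = poly y_num s ->
  poly n s * poly y_num s + 1984 * IZR c * d^2 = 248 * poly n' s * d + poly s_poly s * poly w s ->
  8 * H * d = poly n s -> 8 * (IZR c + y * H) * d = poly n' s.
Proof.
  intros Hs Hd Hy E HH. rewrite Hs, <- Hy, <- HH in E.
  apply Rmult_eq_reg_l with (248 * d); [nra|lra].
Qed.

Ltac ring_poly := cbv [poly fold_right s_poly s_poly' q_num y_num]; ring.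

(** The Horner scheme runs from the leading coefficient down, one [horner_step] per further
    coefficient. The two lists of each step are the new numerator and the quotient; the final
    numerator [[0]] shows that the value vanishes. *)
Lemma y_poly_root (s y : R) :
  poly s_poly s = 0 -> poly s_poly' s <> 0 ->
  248 * y * poly s_poly' s = poly y_num s ->
  poly y_poly y = 0.
Proof.
  intros Hs Hd Hy.
  set (d := poly s_poly' s) in *.
  assert (E : 8 * IZR 833089536 * d = poly
      [959719145472; -47786015784960; -4758607429632; 1856789957836800; 18447534802206720;
       52283819536809984; 187919646740840448; 1405213894812893184; 1786168811246321664;
       2647857324639191040; 2127144907178311680; 276511401035956224; -18443162748321792;
       13059858131582976]%Z s) by (unfold d; ring_poly).
  apply (horner_step _ y _ _ (220028016384) _
      [-210572382965760; -6032183678816256; 4223355411161088; 403945195169415168;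
       3978135715264339968; 11765798278974185472; 44161216593012228096;
       326141356648170995712; 421587463645171740672; 631019321457074122752;
       510735795659539881984; 66907194187143757824; -4485583090069438464; 3202875665312514048]
      [])%Z in E;
    [|exact Hs|exact Hd|exact Hy|unfold d; ring_poly].
  apply (horner_step _ y _ _ (-19474287964848) _
      [2077305481645056; 97337080752350976; 854892744800530176; -17148137344360003584;
       -249003524867691612672; -778325776505183780352; -2957504583291424003584;
       -24544559809412657703936; -32256273990070206323712; -49368552551907587428608;
       -40715291638100001542400; -5394031983782331724800; 366285725067490841088;
       -261674605234929106944]
      [920233352609126756352; 7667374621255520256; -44085773305624442904576;
       -462328134989187595493376; -1336714727116164380024832; -4686114408833811490873344;
       -37123127123384145672437760; -47533659121682170820591616; -71373903533816151235940352;
       -58016409941315040638349312; -7592714329911840520593408; 511646918568745509642240;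
       -361209126202749323771904])%Z in E;
    [|exact Hs|exact Hd|exact Hy|unfold d; ring_poly].
  apply (horner_step _ y _ _ (139707882692901) _
      [-89473683978288; 10932412452139728; -9692795013532242336; 17413201668851824320;
       1262196289396494060192; 4374382587175748464992; 16339287934554998388480;
       155495588674524724164672; 201114482005652038808400; 312073322240797965807696;
       263917013339930347575072; 35347936900964990014080; -2441560581982808986176;
       1720807697378877110784]
      [-10039696845507787631616; -99559700053502334538752; 809374583722589741546496;
       16744316789661124806632448; 50260003300127518837991424; 164031117213116722607585280;
       1708115715118479601937922048; 2227586899197763580731656192;
       3475699922113949346614682624; 2918487600132853151625403392;
       388310990774057946965707776; -26824593942341593348156416; 18769004257939637584453632])%Z in E;
    [|exact Hs|exact Hd|exact Hy|unfold d; ring_poly].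
  apply (horner_step _ y _ _ (-410390834384412) _
      [160560637959384; -116152664840072424; 13166307017990409744; 112795129916801363232;
       -2758638690361737136080; -11452169424049958707632; -40590380014362349668864;
       -417277313208150554642976; -523416332135685562927848; -809214273307888140887208;
       -699387373846775197614672; -94539547195284791093184; 6625842218767625387040;
       -4595326744569390305280]
      [-5114772264790479183984; 737190437513929419818736; 1057808390207449865169888;
       -79854082392490127435490912; -266305246929583096637165472;
       -801130027501288233194440032; -10364601489897519372833427456;
       -13300210490348794674545630208; -21109993545045078294011057520;
       -18225916735866964039845772560; -2453843396746539206633098080;
       172690336433005675700702688; -119094033557325730573769472])%Z in E;
    [|exact Hs|exact Hd|exact Hy|unfold d; ring_poly].
  apply (horner_step _ y _ _ (732430210466916) _
      [-11600267654360808; -228640900274900136; 5785055900676262800; -367491415967975252448;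
       3321306669221869762224; 18862995742970781084624; 65086728660629425354752;
       674494087265198333987040; 837519994105274987902296; 1273545998933777615372184;
       1112491515368990905368624; 151538450880637874018880; -10698049619612572727520;
       7381209002301597505536]
      [9258042926065548437496; -767089058580715268868408; -12784106087034027880781232;
       168271946413737526917691056; 686219786577499785621696720;
       1863069776650328505992860464; 27498828634521237539308190592;
       34180057209873676969367573760; 54123357787579207034511809400;
       47843710755629844630387514824; 6503992798431154997174212080;
       -464743891853993940755585904; 315229136137028972822476800])%Z in E;
    [|exact Hs|exact Hd|exact Hy|unfold d; ring_poly].
  apply (horner_step _ y _ _ (-892396597211316) _
      [27963096907431960; 880868184209122392; -34747878032595166320; 528514072512863088672;
       -2218068752364499301712; -21266194597610377178160; -76416142062306565734912;
       -735341669389472045829408; -909442054927221001082280; -1356709794213729249608040;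
       -1192818318302849050596816; -163619494244231960207808; 11603622385498326290208;
       -7994045882782302584832]
      [54198586167428411033400; -1008749811661230963158136; 31134443076803736583868880;
       -191594975490843508606344912; -1120438485505450968886656432;
       -2909041031802001196597989968; -44193761872992865586577518208;
       -54359916800555447372663721216; -84694837661053490365359618888;
       -75773569037316037193671653240; -10383357514611423825991243152;
       747878691146315008364673552; -504281994525018601744757760])%Z in E;
    [|exact Hs|exact Hd|exact Hy|unfold d; ring_poly].
  apply (horner_step _ y _ _ (782711166381062) _
      [-25866126324458952; -841947204650179464; 37333477703787980112; -449968607325712354912;
       679466785614052633328; 17344395976458538531728; 69550907457669444266496;
       575531288968301884232544; 712426479467270483275128; 1030869721657058502951864;
       905913614979984942733680; 125042946734636848763712; -8873081627630868689760;
       6135052926017371216896]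
      [-149909498517941309261256; 3336545054409399202989192; -39845544814367410713338928;
       110882333489385051419030832; 1246818991353167253188827728;
       3479397668019412837754822064; 47994142381854243253608774528;
       58806267730796451881679577344; 89901122146492490045212128696;
       81045560547688514827072567176; 11186352349783220424034674288;
       -809943526846692210549151728; 544906912058431741020266496])%Z in E;
    [|exact Hs|exact Hd|exact Hy|unfold d; ring_poly].
  apply (horner_step _ y _ _ (-492062343977916) _
      [9557384134966344; 224809915533241608; -17287243802434909008; 256995191535971785824;
       19234665354055061520; -10642590219964079308944; -48196825048054651258368;
       -326015339571151609301856; -405774160911037955983608; -562239726935173149681720;
       -487291581845137417780080; -67369769094328545787200; 4747846788891158055264;
       -3305903143771245441024]
      [142019601403930912752088; -3409720405757748975765528; 31607206848884463537839760;
       -11999070298789711397843088; -993162042332300665805874160;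
       -3330831450306144125775077904; -37398693158058599672254233216;
       -45899306046476148495279042816; -68043407026779596577935322792;
       -61383536234405064885561542424; -8528101470455211561576597840;
       618409690042026269454944976; -417147026747906491582726656])%Z in E;
    [|exact Hs|exact Hd|exact Hy|unfold d; ring_poly].
  apply (horner_step _ y _ _ (216425700787620) _
      [870404397814152; 139498655163047496; 2104589996865733680; -106372542440224162464;
       -46371615588305931120; 4988599352853599497968; 23945162045692773648384;
       129571376383994695821216; 162148805686106272558152; 213962262968557750567176;
       180403968808673812510992; 24820569947740412230848; -1722787499938692784032;
       1211706899513663846400]
      [-52053178956206725117272; 1688938325182364115921816; -17361881606459840432772240;
       -23979082121617692260415600; 592130072236879051316519664;
       2450740574273983857788330256; 21075748350861307083774682752;
       26049206198909757771414261504; 36946154253737027591738030376;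
       32904364599616503475386450072; 4580717438941553287115552592;
       -330270996091942128308100048; 224107686404645284338812928])%Z in E;
    [|exact Hs|exact Hd|exact Hy|unfold d; ring_poly].
  apply (horner_step _ y _ _ (-65960002546284) _
      [-2178261351665208; -133459696507868280; 1536997200023981232; 31989755407826870880;
       -15553036144629164784; -1745796070269426864528; -8011369967508092307456;
       -34545769084273481262432; -43329285108423405484920; -54400734797991733191096;
       -44395037905177951815024; -6070313641270904974656; 413161443264958106976;
       -295433268364744925184]
      [-5888512821639022487832; -358776723160142138413224; 7199127169985331170301168;
       14667410515820043220944912; -272886605996248820923185552;
       -1285908796147832718411015792; -8338393547990966703226787712;
       -10384099727834636216203601664; -14009926574599983713134204056;
       -12144406138171049239502152104; -1683120174569103720537844272;
       119665302745944559712288688; -81930556834101211057873920])%Z in E;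
    [|exact Hs|exact Hd|exact Hy|unfold d; ring_poly].
  apply (horner_step _ y _ _ (14226627485565) _
      [871887851656920; 47442170646245016; -825857020473087600; -6405314538222975456;
       15055588724643331632; 423800922288602222928; 1687241381204442320640;
       5851525256296126937568; 7355300863423798136088; 8757740674074303788760;
       7029305352419697911088; 969081626402435647296; -65352377350312687584;
       47790542301589486080]
      [12722435329946293242408; -39994478397302043895272; -2258680548367271248282512;
       -3202719033182506942155120; 96221112660346937667460080; 449972121557060751622845456;
       2217481126016861111468853888; 2774403459985016081155339008;
       3558272655083947500567751848; 2985316571921731642286734104;
       411268812187698959176470096; -28707624053435094674025168; 19959136825117378777878528])%Z in E;
    [|exact Hs|exact Hd|exact Hy|unfold d; ring_poly].
  apply (horner_step _ y _ _ (-2259294716376) _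
      [-161605635515136; -8363138026574592; 170367336337393152; 723219424522472448;
       -3605877933755364864; -62054090330631547392; -200452550445949833216;
       -575443335655269448704; -733736803696301452032; -819723510467507337984;
       -684527488114076462592; -98825368914120554496; 6862596910912797696;
       -5059663405787455488]
      [-5047503814428715403784; 43553021450930960118984; 484061431290222946234320;
       37333556358187685721264; -24005866152625503267591216; -98132494175070472514834640;
       -375697364549162458718111616; -472471855109074549463756544;
       -574338121186721298092744328; -473874380273338427768372280;
       -65808982458664786850089104; 4555658437710338499881616; -3235659533552324816222976])%Z in E;
    [|exact Hs|exact Hd|exact Hy|unfold d; ring_poly].
  apply (horner_step _ y _ _ (253570773456) _
      [12019208519808; 603333426697344; -13484734738949376; -32960629808773632;
       294538327497808128; 4030300910289620736; 10204586371544076288; 25711888832344963584;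
       34368147605814406272; 35433348897375821952; 33912404300417755392; 5328512573412252672;
       -398486483201382912; 283934352152715264]
      [933510046858682095872; -10224829675468324217088; -59609365187732233007616;
       88956754066290015631872; 3635168358673021249562112; 11956747457371630225476096;
       37064867136447328660905984; 47483975178729985895350272; 54122669686814941887531264;
       46458272191538462613348096; 6748598184377655967308288; -480687125163573750465024;
       344221084166140396892160])%Z in E;
    [|exact Hs|exact Hd|exact Hy|unfold d; ring_poly].
  apply (horner_step _ y _ _ (-14637417984) _
      [0]
      [-69381342006712928640; 859848235583810497920; 3059977948542712366848;
       -9912865665399056527104; -243361444672971521374464; -618319723404733625399040;
       -1664694793164484838615040; -2248735899564131395719168; -2361122108978925831315840;
       -2319525418528441039045248; -365753805214463108819712; 27951547747222252161792;
       -19394251042919976308736])%Z in E;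
    [|exact Hs|exact Hd|exact Hy|unfold d; ring_poly].
  cbv [poly y_poly fold_right] in E |- *.
  apply Rmult_eq_reg_l with (8 * d); [rewrite Rmult_0_r in *; nra|lra].
Qed.

(** The numerator of [delta 3 q s - y * delta 6 q s], and its partial derivatives. *)
Definition crit (q s y : R) : R :=
  (1 - q)^2 * (q * (1 - s)^2 - 16 * s^2 * (1 + 3 * s))
  - 4 * y * s * (q^2 * (1 + 9 * s) * (1 - 3 * s) + 36 * q * s^2 - 12 * s^2 - 4 * q^3).

Definition crit_q (q s y : R) : R :=
  (1 - q)^2 * (1 - s)^2 - 2 * (1 - q) * (q * (1 - s)^2 - 16 * s^2 * (1 + 3 * s))
  - 4 * y * s * (2 * q * (1 + 9 * s) * (1 - 3 * s) + 36 * s^2 - 12 * q^2).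

Definition crit_s (q s y : R) : R :=
  (1 - q)^2 * (- 2 * q * (1 - s) - 32 * s - 144 * s^2)
  - 4 * y * (q^2 * (1 + 12 * s - 81 * s^2) + 108 * q * s^2 - 36 * s^2 - 4 * q^3).

(** With [q] and [y] written over [d], [248 d^4] is a common denominator of all three expressions.
    Each cleared numerator is [s_poly] times the explicit cofactor given. *)
Lemma crit_point (s q y : R) :
  poly s_poly s = 0 -> poly s_poly' s <> 0 ->
  q * poly s_poly' s = poly q_num s -> 248 * y * poly s_poly' s = poly y_num s ->
  crit q s y = 0 /\ crit_q q s y = 0 /\ crit_s q s y = 0.
Proof.
  intros Hs Hd Hq Hy. set (d := poly s_poly' s) in *.
  assert (Eq : q = poly q_num s / d) by (rewrite <- Hq; field; exact Hd).
  assert (Ey : y = poly y_num s / (248 * d)) by (rewrite <- Hy; field; exact Hd).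
  assert (C : forall F : R, F * (248 * d^4) = 0 -> F = 0).
  { intros F HF. apply Rmult_integral in HF. destruct HF as [HF|HF]; [exact HF|].
    exfalso. apply (pow_nonzero d 4 Hd). lra. }
  rewrite Eq, Ey.
  split; [|split]; apply C.
  - transitivity (poly s_poly s * poly
      [-294090891264; 925202233175040; 85796620517096064; -1423904787866719872;
       -130634012664694793856; 3896201962851978492288; -29946961703174204497152;
       -65542161021774872824320; 741357173134874056841472; 8844721497485933579949312;
       -24725094533751896721639552; -319016311382646866445671808;
       -128263837890454929670808448; 4910652521996249025045615744;
       13115539561019297954835687936; -47707094337543726831552255744;
       95123690843697107943389572608; 1488936966841092660322462880256;
       2747043920215695060009114019200; -2350786438557159742447557455232;
       6095791743133231923401656789632; 160836355677454313230782258754176;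
       -39918772977629900424692316136704; -282712975364079998784618505767936;
       1574213889740021505790163276435712; -2447057808929882692863613419731712;
       3767268429602770465563814206628992; -9326398145087612539379411164013184;
       -8691263937420065242390275093790848; -22515385936343002609643462823811200;
       -27452981641264045735834512887519232; -22950272895500234742860232770077440;
       -17946668740912131296404002012973056; -7205692345498222522001311597996032;
       -1005706773707389056289630211558400; -120436263942418905574603121593344;
       -63028393820391866110447213006848; -4426754833443406313646820104192;
       109923501276618751490706210816; -258993935297265961135555411968;
       15220263288078033652931493888; -1935422917332272007843151872]%Z s); [|rewrite Hs; ring].
    unfold crit. field_simplify; [|exact Hd]. unfold d. ring_poly.
  - transitivity (poly s_poly s * poly
      [450979135488; -1895932362461184; 18807299959560192; 7850420437588700544;
       -252174375922016946816; 1923734723129275744128; 8941240842849549111168;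
       -48848427666353596625408; -1098911565267196854403072; 458687984996500447904512;
       40496374861799233998980352; 116754033158537734032311936; -257251553624299988799503744;
       -2186037006525431658396022144; -1311236614125554820474409344;
       -62154302938353383140777916160; -493582646418488030960662839552;
       -1580853729892451333466179616768; -3762401548918501776318566681088;
       -15864859391709118664464498624896; -83308946608860834217727242002816;
       -133086531672714860617811842048896; -239258075245173068458053442995072;
       -1235774429418460195403708774740992; -1495084101371333079626087176361472;
       -4159135320104717406178323032477952; -3510243601017310524701433214870272;
       -2327866683113389590117803971257984; 1352826845638399476457991886738816;
       7521881123077252323230752655554944; 9187551692031428660428684359232896;
       8923195440037625830199740244249856; 5730474246845395792441661611386624;
       1702002235758992403170420831325696; 201588964802369091866000313483264;
       49146301199482251634749893667840; 16713524129101452846063381464064;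
       637250116436114160320578842624; 108452816481881349479768795136;
       64945476455809765184056664064; -4007588211524672392077508608;
       649419296835837521383391232]%Z s); [|rewrite Hs; ring].
    unfold crit_q. field_simplify; [|exact Hd]. unfold d. ring_poly.
  - transitivity (poly s_poly s * poly
      [920402352672768; 85594112991752832; -1412908233604905600; -133611837420284381568;
       4017238544747626224768; -31704241972295961168384; -59264072122424180865792;
       795935519842046668382976; 8900328823433198489959680; -30079746576527860235762304;
       -326965172812762261700129664; 49177910996029719200605056;
       5628686185459877658399646080; 12661284716216259237777722112;
       -59572708979635052199894292992; 73507471159105962559087898112;
       1108740333869583546721615994880; -314528605644562381679827466880;
       -14362348869888981437458173168000; -31610532271344531445563494746752;
       17525908897596174444620139554688; -664572131745228607271293091930112;
       -1735688772619559183470099453293312; -1841941118798157055792268275064064;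
       -13650639845110394039244185810833152; -16653735523070268458059316044084608;
       -54517277256367402162537148576868480; -72398610692506846494527192314093440;
       -104710742716635944807706946511902080; -111246925995808600305429392471601408;
       -85523981147636544617588644625418240; -57777656766732802438200735311913984;
       -21938558908178241934809460291063296; -3128967177271469006413615954753536;
       -385284025925170397640850982473728; -188786348643731561816321256210432;
       -13697017879838559640187780653056; 310473135009291727075356573696;
       -776923407678895409654308601856; 45352294607739034082709209088;
       -5806268751996816023529455616]%Z s); [|rewrite Hs; ring].
    unfold crit_s. field_simplify; [|exact Hd]. unfold d. ring_poly.
Qed.

Lemma crit_point_exists :
  exists q s y : R,
    (24890506/10^8 <= q <= 24890511/10^8 /\ 60501544/10^9 <= s <= 60501545/10^9 /\
     63642/1000 <= y <= 63644/1000) /\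
    (crit q s y = 0 /\ crit_q q s y = 0 /\ crit_s q s y = 0) /\ poly y_poly y = 0.
Proof.
  (* [s_poly] changes sign on this interval of width [10^-11], narrow enough for the enclosures of
     [q] and [y]. *)
  set (l := 6050154482/10^11). set (u := 6050154483/10^11).
  destruct (IVT_cor (poly s_poly) l u (poly_continuity _)) as [s [Hl Hs]].
  - unfold l, u; lra.
  - cut (0 < poly s_poly l /\ poly s_poly u < 0); [nra|].
    unfold l, u. cbv [poly s_poly fold_right]. lra.
  (* With every power of [s] enclosed separately, the values of the polynomials are bounded by
     linear arithmetic. *)
  - assert (P : forall k, l^k <= s^k <= u^k).
    { intros k; split; apply pow_incr; unfold l, u in *; lra. }
    pose proof (P 1%nat) as P1; pose proof (P 2%nat) as P2; pose proof (P 3%nat) as P3;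
    pose proof (P 4%nat) as P4; pose proof (P 5%nat) as P5; pose proof (P 6%nat) as P6;
    pose proof (P 7%nat) as P7; pose proof (P 8%nat) as P8; pose proof (P 9%nat) as P9;
    pose proof (P 10%nat) as P10; pose proof (P 11%nat) as P11; pose proof (P 12%nat) as P12;
    pose proof (P 13%nat) as P13; clear P; unfold l, u in *; clear l u.
    assert (D : -185202618/10^6 <= poly s_poly' s <= -185202612/10^6).
    { cbv [poly s_poly' fold_right]. lra. }
    assert (Q : -460978750/10^7 <= poly q_num s <= -460978700/10^7).
    { cbv [poly q_num fold_right]. lra. }
    assert (Y : -29231428/10 <= poly y_num s <= -29231425/10).
    { cbv [poly y_num fold_right]. lra. }
    clear P1 P2 P3 P4 P5 P6 P7 P8 P9 P10 P11 P12 P13.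
    exists (poly q_num s / poly s_poly' s), s, (poly y_num s / (248 * poly s_poly' s)).
    assert (Hq : poly q_num s / poly s_poly' s * poly s_poly' s = poly q_num s) by (field; lra).
    assert (Hy : 248 * (poly y_num s / (248 * poly s_poly' s)) * poly s_poly' s = poly y_num s)
      by (field; lra).
    split; [|split].
    + split; [|split]; [|lra|]; clear Hl Hs; nra.
    + apply crit_point; auto; lra.
    + apply (y_poly_root s); auto; lra.
Qed.

(** * Nonnegativity of [crit] on the region *)

Lemma Rmult_interval (x y a b c d : R) :
  a <= x <= b -> c <= y <= d -> 0 <= a -> 0 <= c -> a * c <= x * y <= b * d.
Proof. intros; split; apply Rmult_le_compat; lra. Qed.

(** Allows a Taylor coefficient [c] to be replaced by a rounded decimal [c'] at a known cost. *)
Lemma product_error (c c' d v e : R) :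
  - d <= c - c' <= d -> - e <= v <= e -> 0 <= e ->
  c' * v - d * e <= c * v <= c' * v + d * e.
Proof. intros; nra. Qed.

Lemma quadratic_form_nonneg (a b c u v : R) :
  0 < c -> b^2 <= 4 * a * c -> 0 <= u^2 * a + u * v * b + v^2 * c.
Proof.
  intros Hc H. apply Rmult_le_reg_l with (4 * c); [lra|].
  replace (4 * c * (u^2 * a + u * v * b + v^2 * c))
    with ((2 * c * v + u * b)^2 + u^2 * (4 * a * c - b^2)) by ring.
  pose proof (pow2_ge_0 (2 * c * v + u * b)). pose proof (pow2_ge_0 u). nra.
Qed.

Lemma crit_nonneg_middle (q0 s0 y q s : R) :
  24890506/10^8 <= q0 <= 24890511/10^8 -> 60501544/10^9 <= s0 <= 60501545/10^9 ->
  63642/1000 <= y <= 63644/1000 ->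
  crit q0 s0 y = 0 -> crit_q q0 s0 y = 0 -> crit_s q0 s0 y = 0 ->
  1/100 <= s <= 1/10 -> 3 * s <= q -> 0 <= crit q s y.
Proof.
  intros Hq Hs Hy F0 Fq Fs Is Iq.
  (* Taylor expansion at the critical point: [a0 + a1 * u], [b], [c] collect the terms divisible
     by [u^2], by [u * v] only, and by [v^2] only.  As [a1 >= 0], the leading coefficient may be
     replaced by its value at [q = 3 * s]. *)
  set (u := q - q0). set (v := s - s0).
  set (a1 := (s0^2 + 16*s0*y - 2*s0 + 1) + (2*s0 + 16*y - 2) * v + v^2).
  set (a0 := (3*q0*s0^2 + 48*q0*s0*y - 6*q0*s0 + 3*q0 + 108*s0^3*y - 48*s0^3 - 24*s0^2*y
              - 18*s0^2 - 4*s0*y + 4*s0 - 2)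
             + (6*q0*s0 + 48*q0*y - 6*q0 + 324*s0^2*y - 144*s0^2 - 48*s0*y - 36*s0 - 4*y + 4) * v
             + (3*q0 + 324*s0*y - 144*s0 - 24*y - 18) * v^2 + (108*y - 48) * v^3).
  set (b := (6*q0^2*s0 + 48*q0^2*y - 6*q0^2 + 648*q0*s0^2*y - 288*q0*s0^2 - 96*q0*s0*y
             - 72*q0*s0 - 8*q0*y + 8*q0 - 432*s0^2*y + 288*s0^2 + 66*s0 - 2)
            + (3*q0^2 + 648*q0*s0*y - 288*q0*s0 - 48*q0*y - 36*q0 - 432*s0*y + 288*s0 + 33) * v
            + (216*q0*y - 96*q0 - 144*y + 96) * v^2).
  set (c := (q0^3 + 324*q0^2*s0*y - 144*q0^2*s0 - 24*q0^2*y - 18*q0^2 - 432*q0*s0*y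
             + 288*q0*s0 + 33*q0 + 144*s0*y - 144*s0 - 16)
            + (108*q0^2*y - 48*q0^2 - 144*q0*y + 96*q0 + 48*y - 48) * v).
  assert (T : crit q s y = crit q0 s0 y + crit_q q0 s0 y * u + crit_s q0 s0 y * v
                           + (u^2 * (a0 + a1 * u) + u * v * b + v^2 * c)).
  { unfold crit, crit_q, crit_s, a0, a1, b, c, u, v. ring. }
  rewrite T, F0, Fq, Fs. clear T F0 Fq Fs.
  (* The range [1/100 <= s <= 1/10] shifted by [s0]; [Hv] is a symmetric enlargement for use in
     [product_error]. *)
  assert (Lv : - (50502/10^6) <= v <= 39499/10^6) by (unfold v; lra).
  assert (Hv : - (51/1000) <= v <= 51/1000) by (unfold v; lra).
  assert (V2 : - (26011/10^7) <= v^2 <= 26011/10^7) by (clearbody v; clear - Hv; nra).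
  assert (V3 : - (132656/10^9) <= v^3 <= 132656/10^9) by (clearbody v; clear - Hv V2; simpl; nra).
  pose proof (Rmult_interval _ _ _ _ _ _ Hq Hq ltac:(lra) ltac:(lra)) as Q2.
  pose proof (Rmult_interval _ _ _ _ _ _ Hq Q2 ltac:(lra) ltac:(lra)) as Q3.
  pose proof (Rmult_interval _ _ _ _ _ _ Hs Hs ltac:(lra) ltac:(lra)) as S2.
  pose proof (Rmult_interval _ _ _ _ _ _ Hs S2 ltac:(lra) ltac:(lra)) as S3.
  pose proof (Rmult_interval _ _ _ _ _ _ Hq Hs ltac:(lra) ltac:(lra)) as QS.
  pose proof (Rmult_interval _ _ _ _ _ _ Q2 Hs ltac:(lra) ltac:(lra)) as Q2S.
  pose proof (Rmult_interval _ _ _ _ _ _ Hq S2 ltac:(lra) ltac:(lra)) as QS2.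
  pose proof (Rmult_interval _ _ _ _ _ _ Hy Hq ltac:(lra) ltac:(lra)) as YQ.
  pose proof (Rmult_interval _ _ _ _ _ _ Hy Q2 ltac:(lra) ltac:(lra)) as YQ2.
  pose proof (Rmult_interval _ _ _ _ _ _ Hy Hs ltac:(lra) ltac:(lra)) as YS.
  pose proof (Rmult_interval _ _ _ _ _ _ Hy S2 ltac:(lra) ltac:(lra)) as YS2.
  pose proof (Rmult_interval _ _ _ _ _ _ Hy S3 ltac:(lra) ltac:(lra)) as YS3.
  pose proof (Rmult_interval _ _ _ _ _ _ Hy QS ltac:(lra) ltac:(lra)) as YQS.
  pose proof (Rmult_interval _ _ _ _ _ _ Hy Q2S ltac:(lra) ltac:(lra)) as YQ2S.
  pose proof (Rmult_interval _ _ _ _ _ _ Hy QS2 ltac:(lra) ltac:(lra)) as YQS2.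
  (* The leading coefficient at [q = 3 s] is a cubic in [v], with coefficients [A0] to [A3].
     Lowering the constant from [2113/100] to [2112/100] absorbs the rounding of the others. *)
  assert (Ha : 2112/100 + 51531/100 * v + 27433/10 * v^2 + 68285/10 * v^3
               <= a0 + a1 * (3 * s - q0)).
  { replace (3 * s - q0) with (3 * v + (3 * s0 - q0)) by (unfold v; ring).
    set (A0 := (3*q0*s0^2 + 48*q0*s0*y - 6*q0*s0 + 3*q0 + 108*s0^3*y - 48*s0^3 - 24*s0^2*y
              - 18*s0^2 - 4*s0*y + 4*s0 - 2) + (s0^2 + 16*s0*y - 2*s0 + 1) * (3*s0-q0)).
    set (A1 := (6*q0*s0 + 48*q0*y - 6*q0 + 324*s0^2*y - 144*s0^2 - 48*s0*y - 36*s0 - 4*y + 4)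
               + 3 * (s0^2 + 16*s0*y - 2*s0 + 1) + (2*s0 + 16*y - 2) * (3*s0-q0)).
    set (A2 := (3*q0 + 324*s0*y - 144*s0 - 24*y - 18) + 3 * (2*s0 + 16*y - 2) + (3*s0-q0)).
    set (A3 := (108*y - 48) + 3).
    replace (a0 + a1 * (3 * v + (3*s0-q0))) with (A0 + A1 * v + A2 * v^2 + A3 * v^3)
      by (unfold a0, a1, A0, A1, A2, A3; ring).
    assert (B0 : 2113/100 <= A0) by (unfold A0; lra).
    assert (B1 : - (1/10) <= A1 - 51531/100 <= 1/10) by (unfold A1; lra).
    assert (B2 : - (2/10) <= A2 - 27433/10 <= 2/10) by (unfold A2; lra).
    assert (B3 : - (2/10) <= A3 - 68285/10 <= 2/10) by (unfold A3; lra).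
    pose proof (product_error _ _ _ _ _ B1 Hv ltac:(lra)).
    pose proof (product_error _ _ _ _ _ B2 V2 ltac:(lra)).
    pose proof (product_error _ _ _ _ _ B3 V3 ltac:(lra)).
    lra. }
  assert (Hb : - 892/10 - 176543/100 * v - 56708/10 * v^2 - 4/100 <= b <= 0).
  { unfold b.
    match goal with |- _ <= ?B0 + ?B1 * v + ?B2 * v^2 <= _ =>
      assert (E0 : - (3/100) <= B0 + 892/10 <= 3/100) by lra;
      assert (E1 : - (1/10) <= B1 - - 176543/100 <= 1/10) by lra;
      assert (E2 : - (1/2) <= B2 - - 56708/10 <= 1/2) by lra;
      pose proof (product_error _ _ _ _ _ E1 Hv ltac:(lra));
      pose proof (product_error _ _ _ _ _ E2 V2 ltac:(lra))
    end. split; [lra|].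
    enough (- 891/10 - 176543/100 * v - 56708/10 * v^2 <= 0) by lra.
    clear - Lv. clearbody v. nra. }
  assert (Hc : 1092/10 + 11725/10 * v <= c).
  { unfold c.
    match goal with |- _ <= ?B0 + ?B1 * v =>
      assert (E0 : 10922/100 <= B0) by lra;
      assert (E1 : - (2/10) <= B1 - 11725/10 <= 2/10) by lra;
      pose proof (product_error _ _ _ _ _ E1 Hv ltac:(lra))
    end. lra. }
  assert (Ha1 : 0 <= a1 * (q - 3 * s)).
  { apply Rmult_le_pos; [|lra]. unfold a1.
    pose proof (Rmult_le_pos (2*s0 + 16*y - 2) (v + 51/1000) ltac:(lra) ltac:(lra)).
    pose proof (pow2_ge_0 v). pose proof (pow2_ge_0 s0). lra. }
  assert (Ha' : 2112/100 + 51531/100 * v + 27433/10 * v^2 + 68285/10 * v^3 <= a0 + a1 * u).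
  { unfold u. nra. }
  assert (Hc0 : 0 < 1092/10 + 11725/10 * v) by lra.
  rewrite !Rmult_0_l, !Rplus_0_l.
  set (a := a0 + a1 * u) in *. clearbody a b c u v. clear - Lv Ha' Hb Hc Hc0.
  apply quadratic_form_nonneg; [lra|].
  set (A := 2112/100 + 51531/100 * v + 27433/10 * v^2 + 68285/10 * v^3) in *.
  set (B := 8924/100 + 176543/100 * v + 56708/10 * v^2).
  set (C := 1092/10 + 11725/10 * v) in *.
  (* As [b <= 0], its lower bound [-B] controls the square. *)
  assert (HB : b^2 <= B^2) by (assert (- B <= b) by (unfold B; lra); nra).
  assert (HA : 0 <= A) by (unfold A; nra).
  assert (HAC : A * C <= a * c) by (apply Rmult_le_compat; lra).
  assert (B^2 <= 4 * (A * C)); [|lra].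
  (* The quartic has nonnegative Bernstein coefficients on the range of [v]. *)
  assert (Hx : 0 <= v + 50502/10^6) by lra. assert (Hz : 0 <= 39499/10^6 - v) by lra.
  assert (N : forall i j, 0 <= (v + 50502/10^6)^i * (39499/10^6 - v)^j)
    by (intros; apply Rmult_le_pos; apply pow_le; assumption).
  pose proof (N 4%nat 0%nat). pose proof (N 3%nat 1%nat). pose proof (N 2%nat 2%nat).
  pose proof (N 1%nat 3%nat). pose proof (N 0%nat 4%nat).
  unfold A, B, C. clear - H H0 H1 H2 H3. lra.
Qed.

(** For small [s] the factor [s] tames the subtracted term: it is at most [256/100 * 71/1000 * q],
    while the first term is at least [4/9 * 92/100 * q]. *)
Lemma crit_nonneg_small (y q s : R) :
  63642/1000 <= y <= 63644/1000 -> 0 < s <= 1/100 -> 3 * s <= q <= 1/3 ->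
  0 <= crit q s y.
Proof.
  intros Hy Hs Hq. unfold crit.
  assert (HB : q^2 * (1 + 9 * s) * (1 - 3 * s) + 36 * q * s^2 - 12 * s^2 - 4 * q^3
               <= q * (q * (106/100 - 4 * q))).
  { assert (0 <= s^2 * (1 - 3 * q)) by (apply Rmult_le_pos; nra).
    assert (0 <= q^2 * (6/100 - 6 * s + 27 * s^2)) by (apply Rmult_le_pos; nra). nra. }
  assert (HC : q * (106/100 - 4 * q) <= 71/1000) by (pose proof (pow2_ge_0 (q - 1325/10000)); lra).
  assert (HA : 92/100 * q <= q * (1 - s)^2 - 16 * s^2 * (1 + 3 * s)) by nra.
  assert (HD : 4/9 <= (1-q)^2) by nra.
  assert (4/9 * (92/100 * q) <= (1-q)^2 * (q * (1 - s)^2 - 16 * s^2 * (1 + 3 * s)))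
    by (apply Rmult_le_compat; lra).
  assert (HY : 0 <= 4 * y * s <= 256/100) by nra.
  assert (4 * y * s * (q^2 * (1 + 9 * s) * (1 - 3 * s) + 36 * q * s^2 - 12 * s^2 - 4 * q^3)
     <= 4 * y * s * (q * (71/1000))) by (apply Rmult_le_compat_l; nra).
  assert (4 * y * s * (q * (71/1000)) <= 256/100 * (q * (71/1000))) by (apply Rmult_le_compat_r; nra).
  lra.
Qed.

(** Near the cusp, with offsets [sg] and [rh], the line in the last hypothesis bounds [rh] by a
    multiple of [sg]. The numerator of [delta 6] is then quadratically small in [sg], that of
    [delta 3] at least linear, and [sg <= 1/90] makes the linear term win. *)
Lemma crit_nonneg_large (y q s : R) :
  63642/1000 <= y <= 63644/1000 -> 1/10 <= s <= 1/9 -> q <= 1/3 -> 7*s - 9*s^2 <= 2*q ->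
  0 <= crit q s y.
Proof.
  intros Hy Hs Hq L. unfold crit.
  set (sg := 1/9 - s). set (rh := 1/3 - q).
  assert (Es : s = 1/9 - sg) by (unfold sg; ring).
  assert (Eq : q = 1/3 - rh) by (unfold rh; ring). clearbody sg rh.
  assert (Hsg : 0 <= sg <= 1/90) by lra.
  assert (Hrh : 0 <= rh <= 255/100 * sg) by (subst; nra).
  assert (HK : q^2 * (1 + 9 * s) * (1 - 3 * s) + 36 * q * s^2 - 12 * s^2 - 4 * q^3 <= 38/10 * sg^2).
  { subst q s. clear - Hsg Hrh.
    pose proof (pow2_ge_0 (rh - 3/2*sg)).
    assert (0 <= rh^2 * (1/35 - rh)) by (apply Rmult_le_pos; nra).
    assert (rh^2 <= 66/10 * sg^2) by nra.
    assert (0 <= rh * sg^2) by (apply Rmult_le_pos; nra).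
    assert (0 <= (rh * sg)^2) by apply pow2_ge_0.
    pose proof (pow2_ge_0 sg). lra. }
  assert (HA : 34/10 * sg <= q * (1 - s)^2 - 16 * s^2 * (1 + 3 * s)).
  { subst q s. clear - Hsg Hrh.
    assert (0 <= (255/100*sg - rh) * sg) by (apply Rmult_le_pos; nra).
    assert (0 <= (255/100*sg - rh) * sg^2) by (apply Rmult_le_pos; nra).
    assert (0 <= sg * (1/90 - sg)) by (apply Rmult_le_pos; lra). nra. }
  assert (HD : 4/9 <= (1-q)^2) by nra.
  assert (4/9 * (34/10 * sg) <= (1-q)^2 * (q * (1 - s)^2 - 16 * s^2 * (1 + 3 * s)))
    by (apply Rmult_le_compat; lra).
  assert (HY : 0 <= 4 * y * s <= 285/10) by nra.
  assert (4 * y * s * (q^2 * (1 + 9 * s) * (1 - 3 * s) + 36 * q * s^2 - 12 * s^2 - 4 * q^3)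
     <= 4 * y * s * (38/10 * sg^2)) by (apply Rmult_le_compat_l; nra).
  assert (4 * y * s * (38/10*sg^2) <= 285/10 * (38/10*sg^2)) by (apply Rmult_le_compat_r; nra).
  nra.
Qed.

(** * The largest root of [poly7] *)

Lemma poly_nonneg (l : list Z) (x : R) :
  Forall (fun c => 0 <= c)%Z l -> 0 <= x -> 0 <= poly l x.
Proof.
  intros Hl Hx. induction Hl as [|c l Hc _ IH]; simpl; [lra|].
  apply IZR_le in Hc. nra.
Qed.

Lemma poly_le (l : list Z) (x y : R) :
  Forall (fun c => 0 <= c)%Z l -> 0 <= x <= y -> poly l x <= poly l y.
Proof.
  intros Hl Hx. induction Hl as [|c l Hc Hl IH]; simpl; [lra|].
  apply Rplus_le_compat_l, Rmult_le_compat; try lra.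
  apply poly_nonneg; [exact Hl|lra].
Qed.

(** The coefficients of [y_poly] in powers of [y - 60]. Only the constant one is negative, so
    [y_poly] increases strictly from 60 on. *)
Definition y_poly_at_60 : list Z :=
   [-2298016869260331107106649192564224; 160400601688176703917596969934336;
    84896978946995409998394148950924; 9612267010102404477786351177405;
    595663581363692840915141395716; 24126611727661174039919649060;
    686697050875179310919319324; 14213183930920852637422982; 216901832133087071019324;
    2437782572867482057716; 19864793958379589448; 113402919227093541; 425067696808272;
    919823226624; 833089536]%Z.

Lemma y_poly_increasing (y z : R) :
  60 <= y < z -> poly y_poly y < poly y_poly z.
Proof.
  assert (E : forall t, poly y_poly t = poly y_poly_at_60 (t - 60))
    by (intros t; cbv [poly y_poly y_poly_at_60 fold_right]; ring).
  intros H. rewrite !E. unfold y_poly_at_60.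
  match goal with |- poly (?c0 :: ?c1 :: ?l) _ < _ =>
    assert (Hl : Forall (fun c => 0 <= c)%Z l) by (repeat constructor; discriminate);
    pose proof (poly_le l (y - 60) (z - 60) Hl ltac:(lra));
    pose proof (poly_nonneg l (y - 60) Hl ltac:(lra));
    pose proof (poly_nonneg l (z - 60) Hl ltac:(lra));
    change (IZR c0 + (y - 60) * (IZR c1 + (y - 60) * poly l (y - 60))
            < IZR c0 + (z - 60) * (IZR c1 + (z - 60) * poly l (z - 60)));
    assert ((y - 60) * poly l (y - 60) <= (z - 60) * poly l (z - 60))
      by (apply Rmult_le_compat; lra);
    assert (0 <= (y - 60) * poly l (y - 60)) by (apply Rmult_le_pos; lra);
    apply Rplus_lt_compat_l, Rle_lt_trans
      with ((y - 60) * (IZR c1 + (z - 60) * poly l (z - 60)));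
    [apply Rmult_le_compat_l|apply Rmult_lt_compat_r]; lra
  end.
Qed.

(** A root [x > sqrt y] of [poly7] would give [y_poly] a second zero [x^2 > y], against strict
    growth beyond 60. Opposite signs at the squares of two nearby decimals locate [sqrt y]. *)
Lemma sqrt_root_of_y_poly (y : R) :
  60 <= y -> poly y_poly y = 0 ->
  is_largest_root poly7 (sqrt y) /\ Rabs (sqrt y - 79776615835 / 10^10) <= 5 / 10^11.
Proof.
  intros Hy H0.
  assert (E : forall x, poly7 x = poly y_poly (x^2))
    by (intros x; cbv [poly7 poly y_poly fold_right]; ring).
  assert (S : sqrt y ^ 2 = y) by (apply pow2_sqrt; lra).
  pose proof (sqrt_pos y) as Sp.
  split.
  - split; [rewrite E, S; exact H0|].
    intros x Hx. rewrite E in Hx. apply Rnot_lt_le. intros Hlt.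
    assert (y < x^2) by nra.
    pose proof (y_poly_increasing y (x^2) ltac:(lra)). lra.
  - set (lo := 79776615835 / 10^10 - 5 / 10^11). set (hi := 79776615835 / 10^10 + 5 / 10^11).
    assert (Plo : poly y_poly (lo^2) < 0)
      by (unfold lo; cbv [poly y_poly fold_right]; lra).
    assert (Phi : 0 < poly y_poly (hi^2))
      by (unfold hi; cbv [poly y_poly fold_right]; lra).
    assert (Hlo : 60 <= lo^2) by (unfold lo; lra).
    assert (lo <= sqrt y).
    { apply Rnot_lt_le. intros Hlt.
      pose proof (y_poly_increasing y (lo^2) ltac:(split; [lra|nra])). lra. }
    assert (sqrt y <= hi).
    { apply Rnot_lt_le. intros Hlt. assert (0 < hi) by (unfold hi; lra).
      pose proof (y_poly_increasing (hi^2) y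
        ltac:(split; [clear Plo Phi; unfold hi; lra|nra])). lra. }
    apply Rabs_le. unfold lo, hi in *. lra.
Qed.

(** * Combination of the ranges of [s] and passage to distance ratios *)

Lemma crit_nonneg (q0 s0 y q s : R) :
  24890506/10^8 <= q0 <= 24890511/10^8 -> 60501544/10^9 <= s0 <= 60501545/10^9 ->
  63642/1000 <= y <= 63644/1000 ->
  crit q0 s0 y = 0 -> crit_q q0 s0 y = 0 -> crit_s q0 s0 y = 0 ->
  region q s -> 0 <= crit q s y.
Proof.
  intros Hq0 Hs0 Hy F Fq Fs Hr. pose proof Hr as (Hs & Hq & _).
  destruct (Rle_lt_dec s (1/100)); [apply crit_nonneg_small; lra|].
  destruct (Rle_lt_dec s (1/10)); [apply (crit_nonneg_middle q0 s0); try assumption; lra|].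
  apply crit_nonneg_large; try lra.
  apply (linear_lower_cusp q s _ _ (2 * (1 - s)) (2 * (1 - s)) Hr); try lra; ring.
Qed.

Lemma delta_6_le_3 (q s y : R) :
  region q s -> 0 <= crit q s y -> y * delta 6 q s <= delta 3 q s.
Proof.
  intros (Hs & Hq & _) H.
  assert (E : delta 3 q s - y * delta 6 q s = crit q s y / (16 * (s * (1 - q)^2)))
    by (unfold delta, crit; field; lra).
  assert (0 <= crit q s y / (16 * (s * (1 - q)^2))).
  { apply Rle_mult_inv_pos; [exact H|].
    assert (0 < s * (1 - q)^2) by (apply Rmult_lt_0_compat; [lra|apply pow_lt; lra]). lra. }
  lra.
Qed.

Theorem theorem7 :
  exists C7 : R,
    is_largest_root poly7 C7 /\
    Rabs (C7 - 79776615835 / 10^10) <= 5 / 10^11 /\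
    forall A B C : point, nondegenerate A B C ->
      D A B C 7 1 <= 3 / 4 * D A B C 7 2 /\
      D A B C 7 1 <= 2 / 17 * (5 - 2 * sqrt 2) * D A B C 7 3 /\
      D A B C 7 1 <= 1 * D A B C 7 4 /\
      D A B C 7 1 <= 1 / 2 * D A B C 7 8 /\
      D A B C 7 1 <= 1 / 2 * D A B C 7 9 /\
      D A B C 7 1 <= 2 / 3 * D A B C 7 10 /\
      D A B C 7 2 <= 2 / 3 * D A B C 7 3 /\
      2 * D A B C 7 6 <= D A B C 7 2 /\
      1 / 3 * D A B C 7 8 <= D A B C 7 2 <= 2 / 3 * D A B C 7 8 /\
      D A B C 7 2 = 2 / 3 * D A B C 7 9 /\
      2 / 3 * D A B C 7 10 <= D A B C 7 2 <= 8 / 9 * D A B C 7 10 /\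
      1 / 2 * D A B C 7 4 <= D A B C 7 3 /\
      2 * D A B C 7 5 <= D A B C 7 3 /\
      C7 * D A B C 7 6 <= D A B C 7 3 /\
      1 / 2 * D A B C 7 8 <= D A B C 7 3 /\
      1 * D A B C 7 9 <= D A B C 7 3 /\
      1 * D A B C 7 10 <= D A B C 7 3 /\
      1 * D A B C 7 6 <= D A B C 7 4 /\
      D A B C 7 6 <= 1 / 3 * D A B C 7 8 /\
      D A B C 7 6 <= 1 / 3 * D A B C 7 9 /\
      D A B C 7 6 <= 4 / 9 * D A B C 7 10 /\
      1 * D A B C 7 9 <= D A B C 7 8 <= 2 * D A B C 7 9 /\
      4 / 3 * D A B C 7 10 <= D A B C 7 8 <= 2 * D A B C 7 10 /\
      1 * D A B C 7 10 <= D A B C 7 9 <= 4 / 3 * D A B C 7 10.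
Proof.
  destruct crit_point_exists as (q0 & s0 & y & (Hq0 & Hs0 & Hy) & (F & Fq & Fs) & Hroot).
  destruct (sqrt_root_of_y_poly y ltac:(lra) Hroot) as [Hmax Happrox].
  exists (sqrt y). split; [exact Hmax|]. split; [exact Happrox|].
  intros A B C HABC.
  destruct (tangent_lengths A B C HABC) as (x1 & x2 & x3 & (H1 & H2 & H3) & Ha & Hb & Hc).
  pose proof (gergonne_dist_sqr A B C x1 x2 x3 H1 H2 H3 Ha Hb Hc) as HD.
  pose proof (triangle_region x1 x2 x3 H1 H2 H3) as Hr. cbv zeta in HD, Hr.
  set (q := _ / _ ^ 2) in *. set (s := _ / (_ * _)) in *.
  assert (N : forall j, 0 <= D A B C 7 j) by (intros; apply sqrt_pos).
  assert (L : forall i j k, (1 <= i <= 10)%nat -> i <> 7%nat -> (1 <= j <= 10)%nat -> j <> 7%nat ->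
    0 <= k -> k^2 * delta j q s <= delta i q s -> k * D A B C 7 j <= D A B C 7 i).
  { intros i j k Hi Hi7 Hj Hj7 Hk H. apply Rsqr_incr_0_var; [|apply N].
    rewrite !Rsqr_pow2, Rpow_mult_distr, !HD by assumption.
    rewrite <- Rmult_assoc, (Rmult_comm (k^2)), Rmult_assoc.
    apply Rmult_le_compat_l; [apply pow2_ge_0|exact H]. }
  destruct (delta_le q s Hr) as (D21 & D82 & D28 & D102 & D210 & D810 & D108 & D26).
  destruct (delta_3_4_le q s Hr) as (D32 & D38 & D310 & D34 & D35 & D41 & D46).
  assert (D29 : delta 9 q s = 9/4 * delta 2 q s) by (unfold delta; field).
  assert (Ht : 0 < sqrt 2) by (apply sqrt_lt_R0; lra).
  assert (Ht2 : sqrt 2 ^ 2 = 2) by (apply pow2_sqrt; lra).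
  assert (Ht' : sqrt 2 <= 3/2) by nra.
  pose proof (sqrt2_delta_1_le q s (sqrt 2) Hr Ht Ht2) as D31.
  pose proof (delta_6_le_3 q s y Hr
    (crit_nonneg q0 s0 y q s Hq0 Hs0 Hy F Fq Fs Hr)) as D36.
  assert (Hy2 : sqrt y ^ 2 = y) by (apply pow2_sqrt; lra).
  pose proof (sqrt_pos y) as Hy0.
  (* The bound is proved with the reciprocal constant and then inverted using
     [(5 - 2 sqrt 2)(5 + 2 sqrt 2) = 17]. *)
  assert (L31 : (5 + 2 * sqrt 2) / 2 * D A B C 7 1 <= D A B C 7 3).
  { apply L; try lia; [lra|].
    replace (((5 + 2 * sqrt 2) / 2)^2) with ((33 + 20 * sqrt 2) / 4) by (field [Ht2]).
    exact D31. }
  assert (L13 : D A B C 7 1 <= 2 / 17 * (5 - 2 * sqrt 2) * D A B C 7 3).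
  { replace (D A B C 7 1)
      with (2 / 17 * (5 - 2 * sqrt 2) * ((5 + 2 * sqrt 2) / 2 * D A B C 7 1)) by (field [Ht2]).
    apply Rmult_le_compat_l; lra. }
  assert (L36 : sqrt y * D A B C 7 6 <= D A B C 7 3)
    by (apply L; try lia; [exact Hy0|rewrite Hy2; exact D36]).
  (* The remaining bounds of the list follow from these by inverting constants and chaining through
     a common distance; the two bounds between [X2] and [X9] together give the equality. *)
  assert (4/3 * D A B C 7 1 <= D A B C 7 2) by (apply L; lia || lra).
  assert (3/2 * D A B C 7 2 <= D A B C 7 8) by (apply L; lia || lra).
  assert (1/3 * D A B C 7 8 <= D A B C 7 2) by (apply L; lia || lra).
  assert (9/8 * D A B C 7 2 <= D A B C 7 10) by (apply L; lia || lra).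
  assert (2/3 * D A B C 7 10 <= D A B C 7 2) by (apply L; lia || lra).
  assert (4/3 * D A B C 7 10 <= D A B C 7 8) by (apply L; lia || lra).
  assert (1/2 * D A B C 7 8 <= D A B C 7 10) by (apply L; lia || lra).
  assert (2 * D A B C 7 6 <= D A B C 7 2) by (apply L; lia || lra).
  assert (3/2 * D A B C 7 2 <= D A B C 7 9) by (apply L; lia || lra).
  assert (2/3 * D A B C 7 9 <= D A B C 7 2) by (apply L; lia || lra).
  assert (3/2 * D A B C 7 2 <= D A B C 7 3) by (apply L; lia || lra).
  assert (1/2 * D A B C 7 8 <= D A B C 7 3) by (apply L; lia || lra).
  assert (1 * D A B C 7 10 <= D A B C 7 3) by (apply L; lia || lra).
  assert (1/2 * D A B C 7 4 <= D A B C 7 3) by (apply L; lia || lra).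
  assert (2 * D A B C 7 5 <= D A B C 7 3) by (apply L; lia || lra).
  assert (1 * D A B C 7 1 <= D A B C 7 4) by (apply L; lia || lra).
  assert (1 * D A B C 7 6 <= D A B C 7 4) by (apply L; lia || lra).
  repeat split; try assumption; lra.
Qed.
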